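(* Let $N\geq 1$ be an integer, and let $f$ and $g$ be (normalised) cuspidal eigenforms on the group $\Gamma_0(N)$ of weights $k_1$ and $k_2$ respectively, with $k_1\neq k_2$. Then there exists a positive integer $n\leq 4(\log(N)+1)^2$ such that $a_n(f)\neq a_n(g)$.
   Context: A cuspidal eigenform of weight $k$ on $\Gamma_0(N)$ is a nonzero cusp form of weight $k$ (with trivial character) on $\Gamma_0(N)\subset \mathrm{SL}_2(\mathbb{Z})$ that is a simultaneous eigenvector of all Hecke operators $T_n$, $n\geq 1$; it is not required to be a newform. $a_n(f)$ denotes the coefficient of $q^n$ in the Fourier expansion $f=\sum_{n\geq 1}a_n(f)q^n$ at the cusp $\infty$, $q=e^{2\pi i z}$. All cuspidal eigenforms are assumed normalised so that $a_1(f)=1$. $\log$ is the natural logarithm. *)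

(* Defs.v *)
From Stdlib Require Export Reals ZArith Arith ClassicalEpsilon.
From Coquelicot Require Export Coquelicot.

Open Scope R_scope.

Definition CpowZ (z : C) (k : Z) : C :=
  match k with
  | Z0 => RtoC 1
  | Zpos p => Cpow z (Pos.to_nat p)
  | Zneg p => Cinv (Cpow z (Pos.to_nat p))
  end.

(* Functions on the upper half-plane are represented by total functions
   [C -> C]; every predicate below only looks at their values on [upper]. *)
Definition upper (z : C) : Prop := 0 < Im z.

Record mat2 : Set := Mat2 { mA : Z; mB : Z; mC : Z; mD : Z }.

Definition SL2Z (g : mat2) : Prop := (mA g * mD g - mB g * mC g = 1)%Z.

Definition Gamma0 (N : nat) (g : mat2) : Prop :=
  SL2Z g /\ (Z.of_nat N | mC g)%Z.

Definition denom (g : mat2) (z : C) : C :=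
  (RtoC (IZR (mC g)) * z + RtoC (IZR (mD g)))%C.

Definition mobius (g : mat2) (z : C) : C :=
  ((RtoC (IZR (mA g)) * z + RtoC (IZR (mB g))) / denom g z)%C.

(* Weight-[k] action; only applied to matrices of determinant 1, so no
   determinant factor is needed. *)
Definition slash (k : Z) (f : C -> C) (g : mat2) (z : C) : C :=
  (CpowZ (denom g z) (- k) * f (mobius g z))%C.

Definition holomorphic_upper (f : C -> C) : Prop :=
  forall z : C, upper z -> ex_derive (K := C_AbsRing) (V := C_NormedModule) f z.

(* The local parameter exp (2 i pi z / h), in real and imaginary parts. *)
Definition qparam (h : nat) (z : C) : C :=
  (exp (- (2 * PI * Im z / INR h)) * cos (2 * PI * Re z / INR h),
   exp (- (2 * PI * Im z / INR h)) * sin (2 * PI * Re z / INR h)).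

(* f(z) = sum_(n >= 1) a_n exp (2 i pi n z / h) on the upper half-plane. *)
Definition cuspidal_expansion (h : nat) (f : C -> C) (a : nat -> C) : Prop :=
  a 0%nat = RtoC 0 /\
  forall z : C, upper z ->
    is_pseries (K := C_AbsRing) (V := C_NormedModule) a (qparam h z) (f z).

(* Every [slash k f g] with [g] in SL_2(Z) is invariant under Gamma(N), hence
   under z |-> z + N: the expansions at all cusps can be written in
   exp (2 i pi z / N), whatever the exact width of the cusp. *)
Definition cusp_form (N : nat) (k : Z) (f : C -> C) : Prop :=
  holomorphic_upper f /\
  (forall g : mat2, Gamma0 N g ->
     forall z : C, upper z -> slash k f g z = f z) /\
  (forall g : mat2, SL2Z g ->
     exists a : nat -> C, cuspidal_expansion N (slash k f g) a).

(* T_n f (z) = 1/n sum_(a d = n, gcd (a, N) = 1) a^k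
                     sum_(0 <= b < d) f ((a z + b) / d),
   the sum over the upper triangular representatives of Gamma_0(N) acting on
   the integral matrices of determinant n with lower left entry divisible by N
   and upper left entry prime to N. *)
Definition hecke (N : nat) (k : Z) (n : nat) (f : C -> C) (z : C) : C :=
  (RtoC (/ INR n) *
   sum_n_m (G := C_AbelianMonoid)
     (fun a : nat =>
        if ((n mod a =? 0)%nat && (Nat.gcd a N =? 1)%nat)%bool then
          (CpowZ (RtoC (INR a)) k *
           sum_n_m (G := C_AbelianMonoid)
             (fun b : nat =>
                f ((RtoC (INR a) * z + RtoC (INR b)) / RtoC (INR (n / a)))%C)
             0 (n / a - 1))%C
        else RtoC 0)
     1 n)%C.

Definition cuspidal_eigenform (N : nat) (k : Z) (f : C -> C) : Prop :=
  cusp_form N k f /\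
  (exists z : C, upper z /\ f z <> RtoC 0) /\
  (forall n : nat, (1 <= n)%nat ->
     exists lambda : C, forall z : C, upper z ->
       hecke N k n f z = (lambda * f z)%C).

(* The sequence of Fourier coefficients at infinity, in q = exp (2 i pi z);
   it exists and is unique as soon as [f] is a cusp form on some Gamma_0(N). *)
Definition fourier_coeff (f : C -> C) : nat -> C :=
  epsilon (inhabits (fun _ : nat => RtoC 0)) (cuspidal_expansion 1 f).

Definition normalised_eigenform (N : nat) (k : Z) (f : C -> C) : Prop :=
  cuspidal_eigenform N k f /\ fourier_coeff f 1%nat = RtoC 1.

(* Main.v *)
(* For a prime p not dividing N, comparing the coefficients of q and q^p in
   T_p f = a_p(f) f gives a_p(f)^2 = a_(p^2)(f) + p^(k-1). If a_p and a_(p^2)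
   agree for f and g, then p^(k1-1) = p^(k2-1), hence k1 = k2. So some n among
   p and p^2 works, for p the least prime not dividing N. All primes below p
   divide N, so N is at least their product, which is at least 3^((p-2)/2) by a
   Chebyshev estimate; hence p <= 2 (log N + 1). *)

From Stdlib Require Import Lra Lia NArith PeanoNat.
Require Import Defs.
From mathcomp Require all_boot zify.

(** * A Chebyshev lower bound for the product of the primes up to [n] *)

Module Primorial.
Import all_boot zify.
Local Open Scope nat_scope.

Definition primorial n := \prod_(0 <= p < n.+1 | prime p) p.

(** Doubling a real number at most doubles its floor and adds one; for [d > 2 m] both quotients are
    0. This bounds one term of Legendre's formula for ['C(2 m, m)]. *)
Lemma leq_divn2_double m d : 0 < d -> m.*2 %/ d <= (m %/ d).*2 + (d <= m.*2).
Proof.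
move=> d0; case: (leqP d m.*2) => [_|dm]; last by rewrite divn_small.
rewrite addn1 -ltnS ltn_divLR //; have := ltn_ceil m d0; lia.
Qed.

Lemma sum_leq_bool n t : \sum_(1 <= k < n.+1) (k <= t) <= t.
Proof.
apply: (@leq_trans (minn n t)); last exact: geq_minr.
by elim: n => [|n IH]; [rewrite big_nil | rewrite big_nat_recr //=; lia].
Qed.

(** By Legendre's formula the exponent of [p] is the sum over [k] of [2m %/ p ^ k - 2 (m %/ p ^ k)].
    Each term is at most 1 and vanishes once [p ^ k > 2 m], so the exponent is at most the integer
    logarithm of [2 m] in base [p]. *)
Lemma expn_logn_central m p : 0 < m -> prime p ->
  p ^ logn p 'C(m.*2, m) <= m.*2.
Proof.
move=> m0 pp; have p1 := prime_gt1 pp.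
have m20 : 0 < m.*2 by rewrite double_gt0.
suff: logn p 'C(m.*2, m) <= trunc_log p m.*2.
  by move=> h; apply: leq_trans (trunc_logP p1 m20); rewrite leq_exp2l.
have mm : m <= m.*2 by lia.
have := congr1 (logn p) (bin_fact mm).
rewrite (_ : m.*2 - m = m); last lia.
rewrite !lognM ?muln_gt0 ?fact_gt0 ?bin_gt0 // addnn !logn_fact //.
(* The Legendre sum of [m!] is padded with zero terms up to [2 m], so that both sums have the same
   range. *)
rewrite [X in _ + X.*2 = _](_ : _ = \sum_(1 <= k < m.*2.+1) m %/ p ^ k); last first.
  rewrite [RHS](big_cat_nat (n := m.+1)) //=.
  rewrite [X in _ + X](_ : _ = 0) ?addn0 // big_nat_cond big1 // => k /andP[/andP[mk _] _].
  by rewrite divn_small // (leq_trans mk) // ltnW // ltn_expl.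
move=> e; rewrite -(leq_add2r (\sum_(1 <= k < m.*2.+1) m %/ p ^ k).*2) e.
rewrite -[X in _ <= _ + X]mul2n big_distrr /=.
apply: (@leq_trans (\sum_(1 <= k < m.*2.+1) ((k <= trunc_log p m.*2) + 2 * (m %/ p ^ k)))).
  apply: leq_sum => k _; rewrite addnC mul2n.
  apply: leq_trans (leq_divn2_double _ _ _) _; first by rewrite expn_gt0 prime_gt0.
  by rewrite leq_add2l; case: (leqP (p ^ k)) => // h; rewrite trunc_log_max.
by rewrite big_split /= leq_add2r sum_leq_bool.
Qed.

(** An exponent of 2 or more would give [p ^ 2 >= (s + 1) ^ 2]. Hence a prime above [sqrt (2 m)]
    divides the central binomial at most once. *)
Lemma expn_logn_leq_prime p n s :
  prime p -> p ^ logn p n < s.+1 ^ 2 -> s < p -> p ^ logn p n <= p.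
Proof.
move=> pp lt sp; rewrite -{3}(expn1 p) (leq_exp2l _ _ (prime_gt1 pp)) leqNgt.
apply/negP => l1.
have : p ^ 2 <= p ^ logn p n by rewrite (leq_exp2l _ _ (prime_gt1 pp)).
have : s.+1 ^ 2 <= p ^ 2 by rewrite leq_exp2r.
lia.
Qed.

(** In the factorisation of the binomial, a prime at most [s] contributes at most [2 m], a prime
    between [s] and [2 m] at most itself, and a larger prime nothing. *)
Lemma central_leq_primorial m s : 0 < m -> m.*2 < s.+1 ^ 2 ->
  'C(m.*2, m) <= primorial m.*2 * m.*2 ^ s.
Proof.
move=> m0 ms; set n := m.*2 in ms *; set c := 'C(_, _).
have c0 : 0 < c by rewrite bin_gt0 /n; lia.
rewrite -(partnT c0) (widen_partn _ (leq_maxl c n)).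
rewrite (big_cat_nat (n := n.+1)) ?ltnS ?leq_maxr //=.
rewrite [X in _ * X](_ : _ = 1) ?muln1; last first.
  rewrite big_nat_cond big1 // => p.
  move=> /andP[/andP[np _] _]; rewrite lognE; case: ifP => // /and3P[pp _ dv].
  have := expn_logn_central _ _ m0 pp.
  have : p ^ 1 <= p ^ logn p c.
    by rewrite (leq_exp2l _ _ (prime_gt1 pp)) logn_gt0 mem_primes pp c0.
  rewrite expn1 -/c; lia.
have -> : primorial n = \prod_(0 <= p < n.+1) (if prime p then p else 1).
  by rewrite /primorial -big_mkcond big_mkord.
(* The factor [n] is granted to every integer [0 < p <= s], prime or not, which gives [n ^ s] in
   all. *)
apply: (@leq_trans (\prod_(0 <= p < n.+1)
    ((if prime p then p else 1) * n ^ (0 < p <= s)))).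
  rewrite !big_mkord; apply: leq_prod => p _.
  have [pp|pn] := boolP (prime p); last first.
    by rewrite lognE (negbTE pn) /= mul1n expn_gt0; lia.
  have h := expn_logn_central _ _ m0 pp.
  rewrite prime_gt0 //=; case: (leqP p s) => sp.
    by rewrite expn1 (leq_trans h) // leq_pmull // prime_gt0.
  by rewrite muln1 (expn_logn_leq_prime _ _ s) // (leq_ltn_trans h).
rewrite big_split /= leq_mul2l; apply/orP; right.
rewrite -expn_sum; apply: leq_pexp2l; first by rewrite double_gt0.
rewrite big_ltn //= add0n; apply: leq_trans (sum_leq_bool n s).
by apply: leq_sum => p _; lia.
Qed.

(** Induction from [(m + 1) 'C(2m + 2, m + 1) = 2 (2m + 1) 'C(2m, m)], which the absorption
    identities below combine to give. *)
Lemma expn4_leq_central m : 0 < m -> 4 ^ m <= m.*2 * 'C(m.*2, m).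
Proof.
elim: m => // m IH _; case: (posnP m) => [->//|m0].
have := IH m0; rewrite expnS doubleS.
have := mul_bin_diag m.*2.+2 m; have := mul_bin_diag m.*2.+1 m.
have := mul_bin_left m.*2.+1 m; have := mul_bin_diag m.*2.+1 m.-1.
rewrite /= (_ : m.*2.+1 - m = m.+1); last lia.
nia.
Qed.

(** Transfers a comparison of powers to binary numbers, where it can be evaluated. *)
Lemma leq_expn_bin a b c d : N.leb (N.pow a b) (N.pow c d) ->
  N.to_nat a ^ N.to_nat b <= N.to_nat c ^ N.to_nat d.
Proof.
have powE x n : Nat.pow x n = x ^ n by elim: n => //= n ->; rewrite expnS.
move/N.leb_le => h; rewrite -!powE -!Nnat.N2Nat.inj_pow; lia.
Qed.

Lemma expn10_leq_expn2 s : 64 <= s -> s.+1 ^ 10 <= 2 ^ s.-1.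
Proof.
elim: s => // s IH; rewrite leq_eqVlt => /orP[/eqP <-|].
  exact: (@leq_expn_bin 65 10 2 63).
rewrite ltnS => s64; have := IH s64.
rewrite (_ : s.+1.-1 = s.-1.+1); last lia.
move=> h; rewrite [leqRHS]expnS; apply: leq_trans (leq_mul (leqnn 2) h).
(* The left side grows by a factor at most [(9 / 8) ^ 5 < 2] from [s] to [s + 1]. *)
have h2 : 8 * s.+2 ^ 2 <= 9 * s.+1 ^ 2 by nia.
have : (8 * s.+2 ^ 2) ^ 5 <= (9 * s.+1 ^ 2) ^ 5 by rewrite leq_exp2r.
rewrite !expnMn -!expnD; lia.
Qed.

Lemma primorialS n :
  primorial n.+1 = primorial n * (if prime n.+1 then n.+1 else 1).
Proof. by rewrite /primorial big_mkcond big_nat_recr //= -big_mkcond. Qed.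

Lemma primorial_gt0 n : 0 < primorial n.
Proof. by apply: prodn_cond_gt0 => p; apply: prime_gt0. Qed.

Lemma leq_primorial m n : m <= n -> primorial m <= primorial n.
Proof.
elim: n => [|n IH]; first by rewrite leqn0 => /eqP ->.
rewrite leq_eqVlt ltnS => /orP[/eqP -> //|/IH h].
by rewrite primorialS (leq_trans h) // leq_pmulr //; case: ifP.
Qed.

(* With [s = sqrt n], [4 ^ m <= n * 'C(n, m) <= primorial n * n ^ (s + 1)] for
   [n = 2 m]; the last factor is at most [4 ^ (m / 5)] because
   [(s + 1) ^ 10 <= 2 ^ (s - 1)], and [9 ^ 5 <= 4 ^ 8]. *)
Lemma expn3_leq_primorial_large n : 4096 <= n -> 3 ^ n.-1 <= primorial n ^ 2.
Proof.
move=> n4; pose m := n./2.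
have [m0 mn nm] : [/\ 0 < m, m.*2 <= n & n.-1 <= m.*2] by rewrite /m; split; lia.
apply: (@leq_trans (9 ^ m)).
  by rewrite (_ : 9 ^ m = 3 ^ m.*2) ?leq_exp2l // -mul2n expnM.
apply: (@leq_trans (primorial m.*2 ^ 2)); last by rewrite leq_exp2r // leq_primorial.
set P := primorial _.
pose s := Nat.sqrt m.*2.
have [s1 s2] : s ^ 2 <= m.*2 /\ m.*2 < s.+1 ^ 2.
  by have := PeanoNat.Nat.sqrt_spec m.*2; rewrite -/s; lia.
have s64 : 64 <= s by nia.
have h1 : 4 ^ m <= P * m.*2 ^ s.+1.
  apply: leq_trans (expn4_leq_central _ m0) _.
  by rewrite expnS mulnCA leq_mul2l central_leq_primorial ?orbT.
have h2 : (m.*2 ^ s.+1) ^ 10 <= 4 ^ (2 * m).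
  apply: (@leq_trans ((s.+1 ^ 10) ^ (2 * s.+1))).
    rewrite -!expnM (_ : 10 * _ = 2 * (s.+1 * 10)); last lia.
    by rewrite [leqRHS]expnM leq_exp2r; lia.
  apply: (@leq_trans ((2 ^ s.-1) ^ (2 * s.+1))).
    by rewrite leq_exp2r ?expn10_leq_expn2.
  rewrite (_ : 4 ^ (2 * m) = 2 ^ (2 * (2 * m))); last by rewrite [RHS]expnM.
  (* Here [(s - 1) (s + 1) <= s ^ 2 <= 2 m]. *)
  by rewrite -expnM leq_exp2l //; nia.
have h3 : 4 ^ (8 * m) <= P ^ 10.
  rewrite -(@leq_pmul2r (4 ^ (2 * m))) ?expn_gt0 // -expnD -mulnDl mulnC expnM.
  apply: (@leq_trans ((P * m.*2 ^ s.+1) ^ 10)); first by rewrite leq_exp2r.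
  by rewrite expnMn leq_mul2l h2 orbT.
rewrite -(@leq_exp2r _ _ 5) // -expnM -(expnM P 2) (leq_trans _ h3) //.
by rewrite mulnC !expnM leq_exp2r.
Qed.

(** * The cases [n < 4096], by computation *)

Fixpoint primorial_bin (n : nat) : BinNums.N :=
  if n is n'.+1 then
    if prime n then N.mul (N.of_nat n) (primorial_bin n') else primorial_bin n'
  else 1%num.

Lemma primorial_binE n : N.to_nat (primorial_bin n) = primorial n.
Proof.
elim: n => [|n IH]; first by rewrite /primorial big_mkcond big_nat1.
rewrite primorialS -IH [primorial_bin n.+1]/primorial_bin -/primorial_bin.
case: ifP => _; last by rewrite muln1.
by rewrite Nnat.N2Nat.inj_mul Nnat.Nat2N.id mulnC.
Qed.

(* Monotonicity of the primorial extends the inequality from [a] to all [n]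
   such that [a <= n < b]. *)
Definition checkpoint a b :=
  N.leb (N.pow 3 (N.of_nat b.-2)) (N.pow (primorial_bin a) 2).

Lemma expn3_leq_primorial_path a cs n :
  path checkpoint a cs -> a <= n < last a cs -> 3 ^ n.-1 <= primorial n ^ 2.
Proof.
elim: cs a => [|b cs IH] a /=; first by lia.
move=> /andP[ab bcs] /andP[an ncs].
have [bn|nb] := leqP b n; first by apply: (IH b) => //; rewrite bn.
have := @leq_expn_bin 3 _ _ 2 ab; rewrite primorial_binE Nnat.Nat2N.id => h.
(* From [n < b] follows [n - 1 <= b - 2], whence the exponent in [checkpoint]. *)
apply: (@leq_trans (3 ^ b.-2)); first by rewrite leq_exp2l //; lia.
by apply: leq_trans h _; rewrite leq_exp2r // leq_primorial.
Qed.

(** The chain covers [1 <= n < 4096]; from 4096 on, the estimate for large [n] takes over. *)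
Lemma checkpoints : path checkpoint 1
  [:: 2; 3; 5; 7; 11; 13; 19; 31; 47; 73; 113; 193; 317; 547; 929; 1613; 2861;
      4096].
Proof. by vm_compute. Qed.

Lemma expn3_leq_primorial n : 3 ^ n.-1 <= primorial n ^ 2.
Proof.
case: (ltnP n 4096) => [n4|]; last exact: expn3_leq_primorial_large.
case: n n4 => [|n] n4; first by rewrite expn_gt0 primorial_gt0.
exact: (expn3_leq_primorial_path 1 _ _ checkpoints).
Qed.

(** * The least prime not dividing [N] *)

Lemma primorial_dvd n N : (forall p, prime p -> p <= n -> p %| N) ->
  primorial n %| N.
Proof.
elim: n => [|n IH] h; first by rewrite /primorial big_mkcond big_nat1 dvd1n.
rewrite primorialS; have hn : primorial n %| N by apply: IH => p pp pn; apply: h => //; lia.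
case: ifP => pn; last by rewrite muln1.
rewrite Gauss_dvd ?hn ?h // coprime_sym prime_coprime //.
(* A prime [n + 1] dividing the primorial of [n] would divide some prime [q <= n]. *)
rewrite /primorial Euclid_dvd_prod // big_has_cond; apply/hasPn => q.
rewrite mem_index_iota => /andP[_ qn]; apply/negP => /andP[pq].
by move/(dvdn_leq (prime_gt0 pq)); lia.
Qed.

Lemma exists_small_prime_coprime N : 0 < N ->
  exists p, [/\ prime p, coprime p N & 3 ^ p.-2 <= N ^ 2].
Proof.
move=> N0; have ex : exists p, prime p && coprime p N.
  have [p Np pp] := prime_above N; exists p; rewrite pp prime_coprime //=.
  by apply/negP => /(dvdn_leq N0); lia.
case: (ex_minnP ex) => p /andP[pp cp] min; exists p; split => //.
apply: leq_trans (expn3_leq_primorial p.-1) _; rewrite leq_exp2r //.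
apply: dvdn_leq => //; apply: primorial_dvd => q qp qlt.
apply/negPn/negP => ndv; have := min q; rewrite qp prime_coprime // ndv.
by have := prime_gt0 pp; lia.
Qed.

(** Restates the result in the standard library's arithmetic. Primality takes the form of the
    divisibility test that occurs in [hecke]. *)
Lemma exists_small_prime (N : nat) : Peano.le 1 N ->
  exists p, [/\ Peano.le 2 p, forall a, Peano.lt 1 a /\ Peano.lt a p -> Nat.modulo p a <> 0,
    Nat.gcd p N = 1 & Peano.le (Nat.pow 3 (Nat.sub p 2)) (Nat.pow N 2)].
Proof.
have dvdE d n : Nat.divide d n -> d %| n by case=> q ->; apply: dvdn_mull.
have powE x n : Nat.pow x n = x ^ n by elim: n => //= n ->; rewrite expnS.
move=> N1; have [|p [pp cp pN]] := exists_small_prime_coprime N; first exact/leP.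
exists p; split.
- exact/leP/prime_gt1.
- move=> a [/leP a1 /leP ap] /PeanoNat.Nat.Div0.mod_divides pa.
  have /dvdE : Nat.divide a p by case: pa => q ->; exists q; rewrite PeanoNat.Nat.mul_comm.
  by move/(prime_nt_dvdP pp) => h; have := h; lia.
- have : Nat.gcd p N %| gcdn p N.
    by rewrite dvdn_gcd !dvdE //; [apply: PeanoNat.Nat.gcd_divide_r | apply: PeanoNat.Nat.gcd_divide_l].
  by rewrite (eqP cp) dvdn1 => /eqP.
- by apply/leP; rewrite !powE; move: pN; rewrite -subn2.
Qed.

End Primorial.

(* [ring] only recognises the equality and the addition of [C] itself, not
   those of the Coquelicot structures over [C]. *)
Ltac Cring :=
  change (plus ?a ?b) with (Cplus a b);
  match goal with |- @eq _ ?a ?b => change (@eq C a b) end; ring.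

(** * The exponential exp (2 i pi z) and orthogonality of roots of unity *)

Definition e2pi (z : C) : C :=
  (exp (- (2 * PI * Im z)) * cos (2 * PI * Re z),
   exp (- (2 * PI * Im z)) * sin (2 * PI * Re z)).

Lemma e2pi_plus z w : e2pi (z + w)%C = (e2pi z * e2pi w)%C.
Proof.
  destruct z as [x y], w as [u v]; unfold e2pi; simpl.
  replace (- (2 * PI * (y + v))) with (- (2 * PI * y) + - (2 * PI * v)) by ring.
  rewrite exp_plus, Rmult_plus_distr_l, cos_plus, sin_plus.
  apply injective_projections; simpl; ring.
Qed.

Lemma e2pi_nat n : e2pi (RtoC (INR n)) = RtoC 1.
Proof.
  unfold e2pi; simpl; rewrite Rmult_0_r, Ropp_0, exp_0.
  replace (2 * PI * INR n) with (0 + 2 * INR n * PI) by ring.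
  rewrite cos_period, sin_period, cos_0, sin_0.
  apply injective_projections; simpl; ring.
Qed.

Lemma pow_n_Cpow (z : C) n : pow_n (K := C_Ring) z n = (z ^ n)%C.
Proof. induction n as [|n IH]; [reflexivity|]. simpl; rewrite IH; reflexivity. Qed.

Lemma Cpow_e2pi z n : (e2pi z ^ n)%C = e2pi (RtoC (INR n) * z)%C.
Proof.
  induction n as [|n IH].
  - rewrite Cmult_0_l; symmetry; exact (e2pi_nat 0).
  - rewrite Cpow_S, IH, <- e2pi_plus, S_INR, RtoC_plus; f_equal; ring.
Qed.

Lemma qparam_e2pi h z : (0 < h)%nat -> qparam h z = e2pi (z / RtoC (INR h))%C.
Proof.
  intros Hh; apply lt_0_INR in Hh.
  destruct z as [x y]; unfold qparam, e2pi; simpl.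
  do 2 f_equal; f_equal; field; lra.
Qed.

(** With [t = PI m / d], the real part reads [1 - 2 sin(t) ^ 2 = 1]; so [t] is an integer multiple
    of [PI]. *)
Lemma e2pi_fraction_1 m d : (0 < d)%nat ->
  e2pi (RtoC (INR m / INR d)) = RtoC 1 -> (m mod d = 0)%nat.
Proof.
  intros Hd E; apply lt_0_INR in Hd as Hd'.
  apply (f_equal fst) in E; simpl in E.
  rewrite Rmult_0_r, Ropp_0, exp_0, Rmult_1_l in E.
  replace (2 * PI * (INR m / INR d)) with (2 * (PI * (INR m / INR d))) in E by ring.
  rewrite cos_2a_sin in E.
  destruct (sin_eq_0_0 (PI * (INR m / INR d))) as [k Hk]; [nra|].
  assert (H : INR m = IZR k * INR d).
  { assert (PI <> 0) by (generalize PI_RGT_0; lra).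
    apply (Rmult_eq_reg_l PI); auto.
    transitivity (PI * (INR m / INR d) * INR d); [field; lra|rewrite Hk; ring]. }
  rewrite !INR_IZR_INZ, <- mult_IZR in H; apply eq_IZR in H.
  apply Nat2Z.inj; rewrite Nat2Z.inj_mod, H; apply Z_mod_mult.
Qed.

Lemma geometric_sum (x : C) n :
  ((1 - x) * sum_n (G := C_AbelianMonoid) (fun b => x ^ b) n = 1 - x ^ S n)%C.
Proof.
  induction n as [|n IH].
  - rewrite sum_O; simpl; ring.
  - rewrite sum_Sn. change (plus ?a ?b) with (Cplus a b).
    rewrite Cmult_plus_distr_l, IH, !Cpow_S; ring.
Qed.

Lemma sum_n_const_C (c : C) n :
  sum_n (G := C_AbelianMonoid) (fun _ => c) n = (RtoC (INR (S n)) * c)%C.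
Proof.
  induction n as [|n IH].
  - rewrite sum_O; simpl; ring.
  - rewrite sum_Sn, IH, (S_INR (S n)), RtoC_plus.
    Cring.
Qed.

Lemma sum_n_Cmult_r (u : nat -> C) (c : C) n :
  sum_n (G := C_AbelianMonoid) (fun k => u k * c)%C n =
  (sum_n (G := C_AbelianMonoid) u n * c)%C.
Proof.
  induction n as [|n IH]; [rewrite !sum_O; reflexivity|].
  rewrite !sum_Sn, IH; Cring.
Qed.

(** A geometric sum of ratio [x = e2pi (m / d)]. As [x ^ d = 1], its product with [1 - x] is 0, and
    [x = 1] exactly when [d] divides [m]. *)
Lemma roots_of_unity_sum m d : (0 < d)%nat ->
  sum_n (G := C_AbelianMonoid) (fun b => e2pi (RtoC (INR m * INR b / INR d))) (d - 1) =
  if (m mod d =? 0)%nat then RtoC (INR d) else RtoC 0.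
Proof.
  intros Hd; apply lt_0_INR in Hd as Hd'.
  set (x := e2pi (RtoC (INR m / INR d))).
  rewrite (sum_n_ext _ (fun b => (x ^ b)%C)).
  2:{ intros b; unfold x; rewrite Cpow_e2pi, <- RtoC_mult; do 2 f_equal; field; lra. }
  assert (Hx : (x ^ S (d - 1))%C = RtoC 1).
  { replace (S (d - 1)) with d by lia.
    unfold x; rewrite Cpow_e2pi, <- RtoC_mult, <- (e2pi_nat m); do 2 f_equal; field; lra. }
  generalize (geometric_sum x (d - 1)); rewrite Hx; intros G.
  destruct (Nat.eqb_spec (m mod d) 0) as [E|E].
  - assert (x = RtoC 1) as ->.
    { rewrite <- (e2pi_nat (m / d)); unfold x; do 2 f_equal.
      rewrite (Nat.div_mod m d) at 1 by lia.
      rewrite E, Nat.add_0_r, mult_INR; field; lra. }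
    rewrite (sum_n_ext _ (fun _ => RtoC 1)) by (intros b; apply Cpow_1_l).
    rewrite sum_n_const_C; replace (S (d - 1)) with d by lia; Cring.
  - assert (x <> RtoC 1) by (intros E'; apply E, e2pi_fraction_1; auto).
    destruct (Ceq_dec (sum_n (G := C_AbelianMonoid) (fun b => x ^ b)%C (d - 1)) (RtoC 0)) as [H0|H0]; auto.
    exfalso; revert G; replace (1 - 1)%C with (RtoC 0) by ring.
    apply Cmult_neq_0; auto; intros E'; apply H; symmetry.
    replace x with (x + 0)%C by ring; rewrite <- E'; ring.
Qed.

(** * Series supported on multiples of [d], and averages over translates *)

Section Series.
Context {K : AbsRing} {V : NormedModule K}.

Lemma sum_n_multiples (u : nat -> V) d n : (0 < d)%nat ->
  (forall k, (k mod d <> 0)%nat -> u k = zero) ->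
  sum_n u n = sum_n (fun m => u (d * m)%nat) (n / d).
Proof.
  intros Hd Hu; induction n as [|n IH].
  - rewrite Nat.Div0.div_0_l, !sum_O; f_equal; lia.
  - rewrite sum_Sn, IH.
    assert (Hn := Nat.div_mod_eq n d).
    assert (Hr := Nat.mod_upper_bound n d).
    destruct (Nat.eq_dec (S n mod d) 0) as [E|E].
    + assert (Hq := Nat.div_mod_eq (S n) d).
      rewrite E in Hq; destruct (S n / d)%nat as [|q]; [lia|].
      assert (n / d = q)%nat as -> by (symmetry; apply (Nat.div_unique n d _ (d - 1)); lia).
      rewrite sum_Sn; do 2 f_equal; lia.
    + rewrite Hu, plus_zero_r by auto; f_equal.
      apply (Nat.div_unique (S n) d _ (S (n mod d))); [|lia].
      enough (S (n mod d) <> d) by lia; intros H; apply E.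
      replace (S n) with (S (n / d) * d)%nat by nia.
      apply Nat.Div0.mod_mul.
Qed.

(** The partial sums of each series are those of the other, taken along [d * m] or along [n / d];
    both indices tend to infinity. *)
Lemma is_series_multiples (u : nat -> V) d l : (0 < d)%nat ->
  (forall k, (k mod d <> 0)%nat -> u k = zero) ->
  is_series u l <-> is_series (fun m => u (d * m)%nat) l.
Proof.
  intros Hd Hu; unfold is_series; split; intros H.
  - apply filterlim_ext with (fun m => sum_n u (d * m)).
    { intros m; rewrite (sum_n_multiples u d) by auto.
      rewrite Nat.mul_comm, Nat.div_mul by lia; reflexivity. }
    apply (filterlim_comp _ _ _ (fun m => (d * m)%nat) (sum_n u) _ eventually); auto.
    intros P [M HM]; exists M; intros m Hm; apply HM; nia.
  - apply filterlim_ext with (fun n => sum_n (fun m => u (d * m)%nat) (n / d)).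
    { intros n; symmetry; apply sum_n_multiples; auto. }
    apply (filterlim_comp _ _ _ (fun n => (n / d)%nat) _ _ eventually); auto.
    intros P [M HM]; exists (M * d)%nat; intros m Hm; apply HM.
    apply Nat.div_le_lower_bound; lia.
Qed.

Lemma is_series_sum_n (u : nat -> nat -> V) (l : nat -> V) d :
  (forall b, (b <= d)%nat -> is_series (u b) (l b)) ->
  is_series (fun n => sum_n (fun b => u b n) d) (sum_n l d).
Proof.
  induction d as [|d IH]; intros H.
  - rewrite sum_O; apply is_series_ext with (u 0%nat); auto.
    intros n; rewrite sum_O; reflexivity.
  - rewrite sum_Sn.
    apply is_series_ext with (fun n => plus (sum_n (fun b => u b n) d) (u (S d) n)).
    { intros n; rewrite sum_Sn; reflexivity. }
    apply is_series_plus; auto.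
Qed.
End Series.

Lemma pow_n_mult {K : Ring} (x : K) m n : pow_n x (m * n) = pow_n (pow_n x m) n.
Proof.
  induction n as [|n IH]; [rewrite Nat.mul_0_r; reflexivity|].
  rewrite Nat.mul_succ_r, Nat.add_comm, pow_n_plus, IH; reflexivity.
Qed.

(** On Fourier expansions this is the operator [V_d], sending [f(z)] to [f(d z)]. *)
Lemma is_pseries_multiples {K : AbsRing} {V : NormedModule K} (a : nat -> V) x d l :
  (0 < d)%nat -> is_pseries a (pow_n x d) l ->
  is_pseries (fun n => if (n mod d =? 0)%nat then a (n / d)%nat else zero) x l.
Proof.
  intros Hd H; unfold is_pseries; apply is_series_multiples with d; auto.
  { intros k Hk; apply Nat.eqb_neq in Hk; rewrite Hk; apply @scal_zero_r. }
  revert H; apply is_series_ext; intros n; rewrite pow_n_mult.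
  rewrite Nat.mul_comm, Nat.Div0.mod_mul, Nat.div_mul by lia; reflexivity.
Qed.

(* Averaging over the translates kills, by orthogonality of the [d]-th roots of
   unity, the coefficients whose index is not a multiple of [d]. The case
   [h = d = N] turns an expansion in [exp (2 i pi z / N)] of a 1-periodic
   function into one in [exp (2 i pi z)]; the case [h = 1], [d = p] is the
   operator [U_p]. *)
Lemma is_pseries_average h d f a z : (0 < h)%nat -> (0 < d)%nat ->
  cuspidal_expansion h f a -> upper z ->
  is_pseries (K := C_AbsRing) (V := C_NormedModule) (fun m => a (d * m)%nat) (e2pi z)
    (RtoC (/ INR d) * sum_n (G := C_AbelianMonoid)
       (fun b => f ((z + RtoC (INR b)) * RtoC (INR h / INR d))) (d - 1))%C.
Proof.
  intros Hh Hd [_ Hf] Hz.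
  apply lt_0_INR in Hh as Hh'; apply lt_0_INR in Hd as Hd'.
  set (x := e2pi (z / RtoC (INR d))%C).
  (* The translate by [b] multiplies the [n]-th term by the root of unity exp (2 i pi n b / d). *)
  assert (Hb : forall b, is_series (K := C_AbsRing) (V := C_NormedModule)
     (fun n => e2pi (RtoC (INR n * INR b / INR d)) * (x ^ n * a n))%C
     (f ((z + RtoC (INR b)) * RtoC (INR h / INR d))%C)).
  { intros b; set (w := (_ * _)%C).
    assert (Hw : upper w).
    { unfold upper, w in *; destruct z as [u v]; simpl in *.
      assert (0 < INR h / INR d) by (apply Rdiv_lt_0_compat; auto); nra. }
    generalize (Hf w Hw); apply is_series_ext; intros n.
    rewrite pow_n_Cpow, qparam_e2pi, Cpow_e2pi by auto.
    change (scal ?p ?q) with (Cmult p q); unfold x.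
    rewrite Cmult_assoc, Cpow_e2pi, <- e2pi_plus; do 2 f_equal.
    unfold w; rewrite ?RtoC_div, ?RtoC_mult, ?RtoC_div by lra; field.
    split; intros E; apply RtoC_inj in E; lra. }
  generalize (is_series_sum_n _ _ (d - 1) (fun b _ => Hb b)); intros S.
  apply (is_series_scal (RtoC (/ INR d) : C_AbsRing)) in S.
  assert (S' : is_series (K := C_AbsRing) (V := C_NormedModule)
    (fun n => if (n mod d =? 0)%nat then x ^ n * a n else RtoC 0)%C
    (RtoC (/ INR d) * sum_n (G := C_AbelianMonoid)
       (fun b => f ((z + RtoC (INR b)) * RtoC (INR h / INR d))) (d - 1))%C).
  { revert S; apply is_series_ext; intros n.
    change (scal ?p ?q) with (Cmult p q).
    rewrite sum_n_Cmult_r, roots_of_unity_sum by auto.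
    destruct (n mod d =? 0)%nat; [|Cring].
    rewrite Cmult_assoc, <- RtoC_mult, Rinv_l by lra; Cring. }
  apply (is_series_multiples _ d) in S'; auto.
  - revert S'; apply is_series_ext; intros n.
    rewrite (Nat.mul_comm d n), Nat.Div0.mod_mul; simpl Nat.eqb; cbv iota.
    transitivity (pow_n (K := C_Ring) (e2pi z) n * a (n * d)%nat)%C; [|reflexivity].
    rewrite (pow_n_Cpow (e2pi z) n); f_equal.
    unfold x; rewrite !Cpow_e2pi, mult_INR, RtoC_mult; f_equal; field.
    intros E; apply RtoC_inj in E; lra.
  - intros k Hk; apply Nat.eqb_neq in Hk; rewrite Hk; reflexivity.
Qed.

(** * Uniqueness of Fourier coefficients *)

(** Reduces uniqueness to real power series: at a real point the powers are real, and limits in [C]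
    are taken componentwise. *)
Lemma is_pseries_Re_Im (a : nat -> C) r l :
  is_pseries (K := C_AbsRing) (V := C_NormedModule) a (RtoC r) l ->
  is_pseries (fun n => Re (a n)) r (Re l) /\ is_pseries (fun n => Im (a n)) r (Im l).
Proof.
  unfold is_pseries, is_series; intros H.
  assert (E : forall n, sum_n (fun k => scal (pow_n (RtoC r : C_Ring) k) (a k : C_NormedModule)) n =
    (sum_n (fun k => scal (pow_n r k) (Re (a k))) n, sum_n (fun k => scal (pow_n r k) (Im (a k))) n)).
  { assert (T : forall k, scal (pow_n (RtoC r : C_Ring) k) (a k : C_NormedModule) =
       (scal (pow_n r k) (Re (a k)), scal (pow_n r k) (Im (a k)))).
    { intros k; transitivity (RtoC (pow_n (K := R_Ring) r k) * a k)%C.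
      - change (pow_n (K := C_Ring) (RtoC r) k * a k = RtoC (pow_n (K := R_Ring) r k) * a k)%C.
        rewrite (pow_n_Cpow r k), (pow_n_pow r k), RtoC_pow; reflexivity.
      - set (s := pow_n (K := R_Ring) r k).
        change ((RtoC s * a k)%C = (s * Re (a k), s * Im (a k))).
        apply injective_projections; simpl; unfold Re, Im; ring. }
    induction n as [|n IH]; [rewrite !sum_O; apply T|].
    rewrite !sum_Sn, IH, T; reflexivity. }
  split.
  - apply filterlim_ext with (fun n => fst (sum_n (fun k => scal (pow_n (RtoC r : C_Ring) k) (a k : C_NormedModule)) n)).
    { intros n; rewrite E; reflexivity. }
    eapply filterlim_comp; [exact H|]; intros P [e He]; exists e; intros y [Hy _]; apply He, Hy.
  - apply filterlim_ext with (fun n => snd (sum_n (fun k => scal (pow_n (RtoC r : C_Ring) k) (a k : C_NormedModule)) n)).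
    { intros n; rewrite E; reflexivity. }
    eapply filterlim_comp; [exact H|]; intros P [e He]; exists e; intros y [_ Hy]; apply He, Hy.
Qed.

(** Convergence at 1/2 makes the radius positive, so the sum near 0 determines the coefficients. The
    point [r = 0], never a value of exp (2 i pi z), is handled by [a 0 = 0]. *)
Lemma pseries_zero (a : nat -> R) :
  a 0%nat = 0 ->
  (forall r, r <> 0 -> Rabs r < 1 -> is_pseries a r 0) -> forall n, a n = 0.
Proof.
  intros H0 H n.
  assert (Hr : Rbar_lt 0 (CV_radius a)).
  { apply Rbar_lt_le_trans with (/ 2); [simpl; lra|].
    apply Rbar_not_lt_le; intros L; apply (CV_disk_outside a (/ 2)).
    - rewrite Rabs_pos_eq by lra; exact L.
    - apply ex_series_lim_0; exists 0.
      generalize (H (/ 2) ltac:(lra) ltac:(rewrite Rabs_pos_eq; lra)).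
      apply is_series_ext; intros k; rewrite pow_n_pow; apply Rmult_comm. }
  rewrite (PSeries_ext_recip a (fun _ => 0) n Hr); auto.
  - rewrite CV_radius_const_0; exact I.
  - exists (mkposreal 1 Rlt_0_1); intros r Hb; rewrite PSeries_const_0.
    change (Rabs (r - 0) < 1) in Hb; rewrite Rminus_0_r in Hb.
    destruct (Req_dec r 0) as [->|Hr0]; [rewrite PSeries_0; auto|].
    apply is_pseries_unique, H; auto.
Qed.

(** Positive values are taken on the imaginary axis, negative ones on the line of real part 1/2. *)
Lemma e2pi_surj_real r : r <> 0 -> Rabs r < 1 ->
  exists z, upper z /\ e2pi z = RtoC r.
Proof.
  assert (P := PI_RGT_0); assert (Hq : 0 < / 2) by lra.
  assert (L : forall s, 0 < s < 1 -> 0 < - ln s / (2 * PI)).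
  { intros s [Hs H1]; apply Rdiv_lt_0_compat; [|lra].
    generalize (ln_increasing s 1 Hs H1); rewrite ln_1; lra. }
  assert (X : forall s, 0 < s -> exp (- (2 * PI * (- ln s / (2 * PI)))) = s).
  { intros s Hs; rewrite <- (exp_ln s Hs) at 2; f_equal; field; lra. }
  intros Hr H; destruct (Rlt_le_dec 0 r) as [Hp|Hn].
  - rewrite Rabs_pos_eq in H by lra.
    exists (0, - ln r / (2 * PI)); split; [apply L; auto|].
    unfold e2pi; simpl; rewrite X, Rmult_0_r, cos_0, sin_0 by auto.
    apply injective_projections; simpl; ring.
  - rewrite Rabs_left1 in H by lra.
    exists (/ 2, - ln (- r) / (2 * PI)); split; [apply L; lra|].
    unfold e2pi; simpl; rewrite X by lra.
    replace (2 * PI * / 2) with PI by field; rewrite cos_PI, sin_PI.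
    apply injective_projections; simpl; ring.
Qed.

Lemma qparam_1 z : qparam 1 z = e2pi z.
Proof. rewrite qparam_e2pi by lia; f_equal; simpl; field. Qed.

Lemma cuspidal_expansion_unique f a b :
  cuspidal_expansion 1 f a -> cuspidal_expansion 1 f b -> forall n, a n = b n.
Proof.
  intros [Ha0 Ha] [Hb0 Hb] n.
  assert (D : forall r, r <> 0 -> Rabs r < 1 ->
    is_pseries (K := C_AbsRing) (V := C_NormedModule) (fun n => a n - b n)%C (RtoC r) (RtoC 0)).
  { intros r H1 H2; destruct (e2pi_surj_real r H1 H2) as [z [Hz E]].
    rewrite <- E, <- qparam_1; replace (RtoC 0) with (f z - f z)%C by ring.
    generalize (is_pseries_minus a b _ _ _ (Ha z Hz) (Hb z Hz)).
    intros S; exact S. }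
  assert (Z1 := pseries_zero (fun n => Re (a n - b n)%C)).
  assert (Z2 := pseries_zero (fun n => Im (a n - b n)%C)).
  simpl in Z1, Z2; rewrite Ha0, Hb0 in Z1, Z2.
  apply injective_projections.
  - enough (fst (a n) + - fst (b n) = 0) by lra.
    apply Z1; [simpl; ring|].
    intros r H1 H2; apply (is_pseries_Re_Im _ _ _ (D r H1 H2)).
  - enough (snd (a n) + - snd (b n) = 0) by lra.
    apply Z2; [simpl; ring|].
    intros r H1 H2; apply (is_pseries_Re_Im _ _ _ (D r H1 H2)).
Qed.

(** * The Fourier expansion of a cusp form at infinity *)

Lemma CpowZ_1 k : CpowZ (RtoC 1) k = RtoC 1.
Proof.
  destruct k as [|p|p]; simpl; rewrite ?Cpow_1_l; auto.
  field; intros E; apply RtoC_inj in E; lra.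
Qed.

Lemma slash_translation k f b z :
  slash k f (Mat2 1 b 0 1) z = f (z + RtoC (IZR b))%C.
Proof.
  unfold slash, mobius, denom; simpl.
  replace (0 * z + 1)%C with (RtoC 1) by ring.
  rewrite CpowZ_1, Cmult_1_l; f_equal; field.
Qed.

(** Since [fourier_coeff] is a choice, an expansion must be exhibited. The definition provides one
    in exp (2 i pi z / N), and translations by integers lie in [Gamma0 N], so averaging over [N] of
    them returns [f] and keeps the indices divisible by [N]. *)
Lemma cusp_form_expansion N k f : (1 <= N)%nat -> cusp_form N k f ->
  cuspidal_expansion 1 f (fourier_coeff f).
Proof.
  intros HN (_ & Hinv & Hexp).
  assert (Hper : forall b z, upper z -> f (z + RtoC (IZR b))%C = f z).
  { intros b z Hz; rewrite <- (slash_translation k); apply Hinv; auto.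
    split; [unfold SL2Z, mA, mB, mC, mD; lia|exists 0%Z; reflexivity]. }
  destruct (Hexp (Mat2 1 0 0 1) eq_refl) as [a [Ha0 Ha]].
  assert (Ha' : cuspidal_expansion N f a).
  { split; auto; intros z Hz; generalize (Ha z Hz).
    rewrite slash_translation, Hper by auto; auto. }
  unfold fourier_coeff; apply epsilon_spec; exists (fun m => a (N * m)%nat).
  split; [rewrite Nat.mul_0_r; exact Ha0|intros z Hz].
  rewrite qparam_1.
  generalize (is_pseries_average N N f a z HN HN Ha' Hz).
  assert (HN' : 0 < INR N) by (apply lt_0_INR; auto).
  rewrite (sum_n_ext _ (fun _ => f z)).
  - rewrite sum_n_const_C; replace (S (N - 1)) with N by lia.
    rewrite Cmult_assoc, <- RtoC_mult, Rinv_l, Cmult_1_l by lra; auto.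
  - intros b; replace (INR N / INR N) with 1 by (field; lra).
    rewrite Cmult_1_r, INR_IZR_INZ; apply Hper; auto.
Qed.

(** * The Hecke operator at a prime not dividing the level *)

Lemma sum_n_m_ends {G : AbelianMonoid} (F : nat -> G) n : (2 <= n)%nat ->
  (forall a, (1 < a < n)%nat -> F a = zero) -> sum_n_m F 1 n = plus (F 1%nat) (F n).
Proof.
  intros Hn HF; destruct n as [|[|q]]; try lia.
  rewrite sum_Sn_m, sum_n_Sm by lia.
  rewrite (sum_n_m_ext_loc _ (fun _ => zero)), sum_n_m_const_zero, plus_zero_l; auto.
  intros a Ha; apply HF; lia.
Qed.

(** Only the divisors 1 and [p] remain: [T_p = U_p + p^(k-1) V_p]. The factor [INR 1 / INR p]
    matches [is_pseries_average] with [h = 1]. *)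
Lemma hecke_prime N k p f z : (2 <= p)%nat ->
  (forall a, (1 < a < p)%nat -> (p mod a <> 0)%nat) -> Nat.gcd p N = 1%nat ->
  hecke N k p f z =
  (RtoC (/ INR p) * (sum_n (G := C_AbelianMonoid)
      (fun b => f ((z + RtoC (INR b)) * RtoC (INR 1 / INR p)))%C (p - 1) +
   CpowZ (RtoC (INR p)) k * f (RtoC (INR p) * z)))%C.
Proof.
  intros Hp Hprime Hgcd; unfold hecke; f_equal.
  assert (Hp' : 0 < INR p) by (apply lt_0_INR; lia).
  rewrite sum_n_m_ends; auto.
  2:{ intros a Ha; replace (p mod a =? 0)%nat with false; [reflexivity|].
      symmetry; apply Nat.eqb_neq, Hprime; lia. }
  rewrite Nat.mod_1_r, (Nat.divide_1_r _ (Nat.gcd_divide_l 1 N)), Nat.Div0.mod_same, Hgcd, Nat.div_1_r, Nat.div_same by lia.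
  simpl Nat.eqb; cbv [andb].
  change (plus ?a ?b) with (Cplus a b); f_equal.
  - rewrite CpowZ_1, Cmult_1_l; apply sum_n_ext; intros b.
    f_equal; simpl INR; rewrite RtoC_div by lra; field.
    intros E; apply RtoC_inj in E; lra.
  - f_equal; simpl (1 - 1)%nat; rewrite sum_n_n; f_equal; simpl INR; field.
Qed.

(** The [U_p] part comes from averaging, the [V_p] part from replacing [q] by [q ^ p]; [p^(k-1)] is
    written as [/ p] times [p ^ k]. *)
Lemma hecke_prime_expansion N k p f a : (2 <= p)%nat ->
  (forall a, (1 < a < p)%nat -> (p mod a <> 0)%nat) -> Nat.gcd p N = 1%nat ->
  cuspidal_expansion 1 f a ->
  cuspidal_expansion 1 (hecke N k p f)
    (fun m => a (p * m)%nat + RtoC (/ INR p) * CpowZ (RtoC (INR p)) k *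
       (if (m mod p =? 0)%nat then a (m / p)%nat else RtoC 0))%C.
Proof.
  intros Hp Hprime Hgcd Ha; assert (Hp' : 0 < INR p) by (apply lt_0_INR; lia).
  split.
  { rewrite Nat.mul_0_r, Nat.Div0.mod_0_l, Nat.Div0.div_0_l; simpl Nat.eqb; cbv iota.
    rewrite (proj1 Ha); ring. }
  intros z Hz; rewrite hecke_prime, Cmult_plus_distr_l, Cmult_assoc by auto.
  set (c := (RtoC (/ INR p) * CpowZ _ _)%C); rewrite qparam_1.
  apply (is_pseries_plus (K := C_AbsRing) (V := C_NormedModule)).
  - apply is_pseries_average; auto; lia.
  - apply (is_pseries_scal (K := C_AbsRing) (V := C_NormedModule) c).
    { apply Cmult_comm. }
    apply (is_pseries_multiples (K := C_AbsRing) (V := C_NormedModule) a (e2pi z) p); [lia|].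
    change (pow_n (K := AbsRing.Ring C_AbsRing) (e2pi z) p) with (pow_n (K := C_Ring) (e2pi z) p).
    rewrite (pow_n_Cpow (e2pi z) p), Cpow_e2pi, <- qparam_1; apply Ha.
    unfold upper in *; simpl; destruct z as [u v]; simpl in *; nra.
Qed.

Lemma eigenform_coeff_prime_square N k p f : (1 <= N)%nat -> (2 <= p)%nat ->
  (forall a, (1 < a < p)%nat -> (p mod a <> 0)%nat) -> Nat.gcd p N = 1%nat ->
  normalised_eigenform N k f ->
  (fourier_coeff f p * fourier_coeff f p =
   fourier_coeff f (p * p)%nat + RtoC (/ INR p) * CpowZ (RtoC (INR p)) k)%C.
Proof.
  intros HN Hp Hprime Hgcd [(Hcusp & _ & Heig) H1].
  apply cusp_form_expansion in Hcusp; auto.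
  set (a := fourier_coeff f) in *.
  destruct (Heig p ltac:(lia)) as [l Hl].
  assert (E : cuspidal_expansion 1 (hecke N k p f) (fun m => l * a m)%C).
  { split; [rewrite (proj1 Hcusp); ring|].
    intros z Hz; rewrite Hl by auto.
    apply (is_pseries_scal (K := C_AbsRing) (V := C_NormedModule) l).
    - apply Cmult_comm.
    - apply Hcusp; auto. }
  assert (U := cuspidal_expansion_unique _ _ _ E
    (hecke_prime_expansion N k p f a Hp Hprime Hgcd Hcusp)).
  assert (U1 := U 1%nat); assert (Up := U p); cbv beta in U1, Up.
  (* At index 1 the [V_p] term vanishes because [p >= 2], so the eigenvalue is [a p]; index [p] then
     gives the relation. *)
  rewrite Nat.mod_small in U1 by lia; simpl Nat.eqb in U1; cbv iota in U1.
  rewrite Nat.mul_1_r, H1 in U1.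
  rewrite Nat.Div0.mod_same, Nat.div_same in Up by lia; simpl Nat.eqb in Up; cbv iota in Up.
  rewrite H1 in Up.
  assert (El : l = a p) by (transitivity (l * 1)%C; [ring|rewrite U1; ring]).
  rewrite El in Up; rewrite Up; ring.
Qed.

(** * Recovering the weight, the size of [p], and the conclusion *)

Lemma CpowZ_inj (x : R) k1 k2 : 1 < x ->
  CpowZ (RtoC x) k1 = CpowZ (RtoC x) k2 -> k1 = k2.
Proof.
  intros Hx.
  assert (E : forall k, CpowZ (RtoC x) k = RtoC (powerRZ x k)).
  { intros [|p|p]; simpl; rewrite <- ?RtoC_pow; auto.
    rewrite RtoC_inv; auto; apply pow_nonzero; lra. }
  rewrite !E; intros H; apply RtoC_inj in H.
  rewrite !powerRZ_Rpower in H by lra; unfold Rpower in H.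
  apply exp_inv in H; apply Rmult_eq_reg_r in H; [apply eq_IZR; auto|].
  generalize (ln_increasing 1 x); rewrite ln_1; lra.
Qed.

Lemma Cplus_Cmult_inv_inj (s c x y : C) :
  c <> RtoC 0 -> (s + / c * x = s + / c * y)%C -> x = y.
Proof.
  intros Hc E; replace x with (c * ((s + / c * x) - s))%C by (field; auto).
  rewrite E; field; auto.
Qed.

(** Taking logarithms gives [(p - 2) ln 3 <= 2 ln N], and [ln 3 >= 1] because [e <= 3]. *)
Lemma small_prime_bound N p : (1 <= N)%nat -> (2 <= p)%nat -> (3 ^ (p - 2) <= N ^ 2)%nat ->
  INR p <= 2 * (ln (INR N) + 1).
Proof.
  intros HN Hp H; apply le_INR in H; rewrite !pow_INR in H.
  assert (HN' : 0 < INR N) by (apply lt_0_INR; lia).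
  replace (INR 3) with 3 in H by (simpl; ring).
  assert (L : ln (3 ^ (p - 2)) <= ln (INR N ^ 2)).
  { apply ln_le; auto; apply pow_lt; lra. }
  rewrite !ln_pow in L by lra; rewrite minus_INR in L by lia; simpl in L.
  assert (1 <= ln 3).
  { rewrite <- (ln_exp 1); apply ln_le; [apply exp_pos|exact exp_le_3]. }
  assert (2 <= INR p) by (apply (le_INR 2); auto).
  nra.
Qed.

Theorem theorem1 (N : nat) (k1 k2 : Z) (f g : C -> C)
  (hN : (1 <= N)%nat)
  (hf : normalised_eigenform N k1 f)
  (hg : normalised_eigenform N k2 g)
  (hk : k1 <> k2) :
  exists n : nat,
    (1 <= n)%nat /\
    INR n <= 4 * (ln (INR N) + 1) ^ 2 /\
    fourier_coeff f n <> fourier_coeff g n.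
Proof.
  destruct (Primorial.exists_small_prime N hN) as [p [Hp Hprime Hgcd HpN]].
  assert (Hb := small_prime_bound N p hN Hp HpN).
  assert (Hp2 : 2 <= INR p) by (apply (le_INR 2); auto).
  destruct (Ceq_dec (fourier_coeff f p) (fourier_coeff g p)) as [E|E].
  (* The bound of the theorem is the square of the bound on [p]. *)
  - exists (p * p)%nat; split; [nia|split].
    + rewrite mult_INR; nra.
    + intros E2.
      assert (Ef := eigenform_coeff_prime_square N k1 p f hN Hp Hprime Hgcd hf).
      assert (Eg := eigenform_coeff_prime_square N k2 p g hN Hp Hprime Hgcd hg).
      rewrite E, E2, Eg in Ef; apply hk, (CpowZ_inj (INR p)); [lra|symmetry].
      (* Equal coefficients at [p] and [p * p] leave [p^(k1-1) = p^(k2-1)]. *)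
      revert Ef; rewrite RtoC_inv by lra; apply Cplus_Cmult_inv_inj.
      intros H; apply RtoC_inj in H; lra.
  - exists p; split; [lia|split; [nra|exact E]].
Qed.
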